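(* Let $R = k[x_1,\dots,x_n]$ be a polynomial ring over a field $k$, $n\ge 1$, let $I$ be a nonzero monomial ideal in $R$, and let $r$ be an integer. If $\operatorname{reg}(I:x) \le r$ for all variables $x$ of $R$ (i.e. for all $x\in\{x_1,\dots,x_n\}$), then $\operatorname{reg} I \le r+1$.
   Context: $R$ has the standard grading and $\mathfrak m=(x_1,\dots,x_n)$. For a finitely generated graded $R$-module $M$ with local cohomology modules $H^i_{\mathfrak m}(M)$, $\operatorname{reg} M := \max\{i+j \mid H^i_{\mathfrak m}(M)_j \neq 0\}$ (Castelnuovo-Mumford regularity); here ideals are regarded as graded $R$-modules. $I:x=\{g\in R\mid gx\in I\}$. *)

(* Defs.v *)
From HB Require Import structures.
From mathcomp Require Import all_boot all_order all_algebra.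
From mathcomp Require Import mpoly.

Set Implicit Arguments.
Unset Strict Implicit.
Unset Printing Implicit Defensive.

Import Order.TTheory GRing.Theory Num.Theory.
Local Open Scope ring_scope.

(* Local cohomology with support in m = (x_1, ..., x_n), as the cohomology of
   the Cech complex on x_1, ..., x_n,
     0 -> M -> (+)_i M_{x_i} -> (+)_{i<j} M_{x_i x_j} -> ... -> M_{x_1...x_n}.
   A graded R-module M is given by an R-module V together with its homogeneous
   components M_j, as subsets of V; M is then the submodule (+)_j M_j of V. *)
Section LocalCohomology.

Variables (k : fieldType) (n : nat).
Local Notation R := {mpoly k[n]}.
Variables (V : lmodType R) (M : int -> {pred V}).

Implicit Types (S T : {set 'I_n}) (u v : V * nat) (c b : {set 'I_n} -> V * nat).

Definition xprod S : R := \prod_(i in S) 'X_i.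

(* The pair (m, a) stands for the fraction m / (xprod S) ^ a of V_{xprod S}. *)
Definition loc_eq S u v : Prop :=
  exists l : nat, xprod S ^+ (l + v.2) *: u.1 = xprod S ^+ (l + u.2) *: v.1.

Definition loc0 : V * nat := (0, 0%N).

Definition loc_add S u v : V * nat :=
  (xprod S ^+ v.2 *: u.1 + xprod S ^+ u.2 *: v.1, (u.2 + v.2)%N).

(* The localization map V_{xprod (T :\ t)} -> V_{xprod T}, for t \in T. *)
Definition loc_res (t : 'I_n) u : V * nat := ('X_t ^+ u.2 *: u.1, u.2).

Definition loc_scale (a : R) u : V * nat := (a *: u.1, u.2).

Definition cech_sign T (t : 'I_n) : R :=
  (-1) ^+ #|[set s in T | (s < t)%N]|.

Definition cech_d c T : V * nat :=
  \big[loc_add T/loc0]_(t in T)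
     loc_scale (cech_sign T t) (loc_res t (c (T :\ t))).

(* Degree j part of the p-th term of the Cech complex of M; only the values of
   c at sets of cardinality p matter. *)
Definition cech_cochain (p : nat) (j : int) c : Prop :=
  forall S, #|S| = p -> (c S).1 \in M (j + ((c S).2 * #|S|)%N%:Z).

Definition cech_cocycle (p : nat) (j : int) c : Prop :=
  cech_cochain p j c /\
  forall T, #|T| = p.+1 -> loc_eq T (cech_d c T) loc0.

(* For p = 0 the conditions on b are void and cech_d b set0 = loc0, so that
   the term of index -1 is zero. *)
Definition cech_coboundary (p : nat) (j : int) c : Prop :=
  exists b, (forall q, q.+1 = p -> cech_cochain q j b) /\
            (forall S, #|S| = p -> loc_eq S (c S) (cech_d b S)).

(* H^p_m(M)_j <> 0 *)
Definition local_cohomology_neq0 (p : nat) (j : int) : Prop :=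
  exists c, cech_cocycle p j c /\ ~ cech_coboundary p j c.

(* reg M = s; the maximum exists whenever M is finitely generated and nonzero. *)
Definition is_reg (s : int) : Prop :=
  (exists (p : nat) (j : int), local_cohomology_neq0 p j /\ s = p%:Z + j) /\
  (forall (p : nat) (j : int), local_cohomology_neq0 p j -> p%:Z + j <= s).

End LocalCohomology.

Section Ideals.

Variables (k : fieldType) (n : nat).
Local Notation R := {mpoly k[n]}.
Implicit Types (I : {pred R}).

(* I is generated by a set of monomials, and thus is an ideal. *)
Definition monomial_ideal I : Prop :=
  exists G : {pred 'X_{1..n}}, forall f : R,
    f \in I <->
    exists2 s : seq (R * 'X_{1..n}),
      all (fun t => t.2 \in G) s & f = \sum_(t <- s) t.1 * 'X_[t.2].

Definition colon I (x : R) : {pred R} := [pred g | g * x \in I].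

(* The homogeneous component I_j, in R seen as a module over itself. *)
Definition ideal_part I (j : int) : {pred R^o} :=
  [pred g : R | (g \in I) &&
     match j with Posz d => g \is d.-homog | Negz _ => g == 0 end].

Definition is_ideal_reg I (s : int) : Prop := is_reg (ideal_part I) s.

End Ideals.

(* Main.v *)
Require Import Defs.
From HB Require Import structures.
From mathcomp Require Import all_boot all_order all_algebra.
From mathcomp Require Import zify.
From mathcomp Require Import mpoly.
From Stdlib Require Import Classical.
Set Implicit Arguments.
Unset Strict Implicit.
Unset Printing Implicit Defensive.
Import Order.TTheory GRing.Theory Num.Theory.
Local Open Scope ring_scope.

(** The ideal I is Z^n-graded, hence so is its Cech complex. In degree a in Z^n
    the summand I_{x_S} contributes a copy of k when x^a lies in I_{x_S}, and 0
    otherwise; so the strand of degree a only sees the family F_a(I) of those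
    sets S, which is closed under supersets, with the usual simplicial signs.
    Thus H^p_m(I)_j is nonzero exactly when, for some a of total degree j, the
    p-th cohomology of the set cochains supported on F_a(I) is nonzero
    (local_cohomology_slices).

    Colons act on these families by a shift: F_a(I : x_i) is F_a(I) when
    a_i < 0 and F_{a + e_i}(I) when a_i >= 0. If H^p(I) is nonzero in a degree
    a having a negative entry a_i, it is also nonzero for I : x_i in degree a,
    so p + |a| <= r. If a has a positive entry a_i, then H^p(I : x_i) is nonzero
    in degree a - e_i, so p + |a| <= r + 1.

    There remains a = 0, where no colon sees F = F_0(I) directly. For A
    nonempty, however, the degree -1_A has negative entries, and F_{-1_A}(I) is
    the star {S in F | A is a subset of S}. So the stars of the nonempty sets A
    have no cohomology above r + |A|, and this alone forces H^p(F) = 0 for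
    p > r + 1 (acyclic_of_stars): a cocycle that is a coboundary on all sets
    avoiding B + i is corrected, by a cochain supported on the star of i, to be
    a coboundary on all sets avoiding B. The obstruction to this correction
    lies in the cohomology of the sets of the star of i that avoid B,
    which vanishes by an induction on B through the stars of larger A
    (acyclic_star_off). For B the whole vertex set only S = set0 is left, and
    there a cocycle vanishes because n >= 1.

    The same shift of families carries a nonzero class of some I : x_i to a
    nonzero class of I, so the set of values p + j is nonempty as well as
    bounded, and the regularity exists. *)

(** * Cochains on families of subsets *)

Section SetCochains.

Variables (k : fieldType) (n : nat).
Implicit Types (S T A B : {set 'I_n}) (c b : {set 'I_n} -> k).
Implicit Types (F : {set 'I_n} -> Prop) (p q : nat).

Definition sgn T (t : 'I_n) : k := (-1) ^+ #|[set s in T | (s < t)%N]|.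

Definition set_d c T : k := \sum_(t in T) sgn T t * c (T :\ t).

Lemma sgn_neq0 T t : sgn T t != 0.
Proof. by rewrite expf_neq0 // oppr_eq0 oner_eq0. Qed.

(** This and the next lemma are the asymmetry behind d d = 0: removing the
    smaller of two elements shifts the position of the larger one, but not
    conversely. *)
Lemma sgn_setD1_gt T (t u : 'I_n) : t \in T -> (t < u)%N ->
  sgn (T :\ t) u = - sgn T u.
Proof.
move=> tT ltu; rewrite /sgn [in RHS](cardsD1 t) !inE tT ltu /= add1n exprS.
rewrite mulN1r opprK; congr (_ ^+ _).
by apply: eq_card => s; rewrite !inE andbA.
Qed.

Lemma sgn_setD1_lt T (t u : 'I_n) : (t < u)%N -> sgn (T :\ u) t = sgn T t.
Proof.
move=> ltu; congr (_ ^+ _); apply: eq_card => s; rewrite !inE.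
by case: eqVneq => // ->; rewrite [(u < t)%N]ltnNge ltnW //= andbF.
Qed.

Lemma set_d_eq q c c' T : #|T| = q.+1 ->
    (forall t, t \in T -> #|T :\ t| = q -> c (T :\ t) = c' (T :\ t)) ->
  set_d c T = set_d c' T.
Proof.
move=> cT h; apply: eq_bigr => t tT; rewrite h //.
by move: cT; rewrite (cardsD1 t) tT => -[].
Qed.

Lemma set_dD c c' T : set_d (fun S => c S + c' S) T = set_d c T + set_d c' T.
Proof. by rewrite -big_split; apply: eq_bigr => t _; rewrite mulrDr. Qed.

Lemma set_dB c c' T : set_d (fun S => c S - c' S) T = set_d c T - set_d c' T.
Proof.
by rewrite -sumrB; apply: eq_bigr => t _; rewrite mulrBr.
Qed.

Lemma set_d0 T : set_d (fun=> 0) T = 0.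
Proof. by apply: big1 => t _; rewrite mulr0. Qed.

Lemma set_d_neq0 c T : set_d c T != 0 -> exists2 t, t \in T & c (T :\ t) != 0.
Proof.
move=> h; apply: NNPP => nex; case/negP: h; apply/eqP; apply: big1 => t tT.
have [->|ct] := eqVneq (c (T :\ t)) 0; first by rewrite mulr0.
by case: nex; exists t.
Qed.

(** The terms removing t then u and u then t cancel. *)
Lemma set_d_set_d c T : set_d (set_d c) T = 0.
Proof.
pose G t u := sgn T t * (sgn (T :\ t) u * c (T :\ t :\ u)).
transitivity (\sum_(x | (x.1 \in T) && (x.2 \in T :\ x.1)) G x.1 x.2).
  rewrite -(pair_big_dep (mem T) (fun t u => u \in T :\ t) G) /=.
  by apply: eq_bigr => t _; rewrite mulr_sumr.
rewrite (bigID (fun x : 'I_n * 'I_n => (x.1 < x.2)%N)) /=.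
apply/eqP; rewrite addr_eq0 -sumrN; apply/eqP.
rewrite [RHS](reindex_inj (h := fun x => (x.2, x.1))) /=; last first.
  by move=> [x y] [x' y'] /= [-> ->].
apply: eq_big => [[t u]|[t u]] /=.
  rewrite !inE -leqNgt (ltn_neqAle t u) (eq_sym u t).
  by rewrite (inj_eq val_inj); case: (t \in T); case: (u \in T); case: (t == u).
rewrite !inE => /andP[/and3P[tT _ uT] ltu].
rewrite /G (sgn_setD1_gt tT ltu) (sgn_setD1_lt T ltu).
rewrite (_ : T :\ u :\ t = T :\ t :\ u); last first.
  by apply/setP=> s; rewrite !inE andbCA.
by rewrite mulNr mulrN mulrCA.
Qed.

Definition supported F q c := forall S, #|S| = q -> c S != 0 -> F S.

(** Vanishing of the p-th cohomology of the cochains on the sets of F that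
    avoid B. When F is closed under supersets this is a locally closed family,
    and its cochain complex is the quotient of the one of F by the cochains
    living on sets that meet B; a cochain is represented here by a lift to F.
    B = set0 gives the cohomology of F itself. *)
Definition acyclic F B p := forall c,
    supported F p c ->
    (forall T, #|T| = p.+1 -> [disjoint T & B] -> set_d c T = 0) ->
  exists b, (forall q, q.+1 = p -> supported F q b) /\
            (forall S, #|S| = p -> [disjoint S & B] -> c S = set_d b S).

Lemma acyclic_ext F F' B p : (forall S, F S <-> F' S) ->
  acyclic F B p -> acyclic F' B p.
Proof.
move=> FF' aF c cF' dc.
case: (aF c _ dc) => [S cS /cF' /FF'|b [bF cb]]; first by auto.
by exists b; split=> // q /bF bq S /bq h /h /FF'.
Qed.

Definition star F A S := F S /\ A \subset S.

Definition upclosed F := forall S T, S \subset T -> F S -> F T.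

Lemma star_upclosed F A : upclosed F -> upclosed (star F A).
Proof.
by move=> uF S T sST [FS sAS]; split; [apply: uF FS|apply: subset_trans sST].
Qed.

Lemma supported_set_d F q c : upclosed F ->
  supported F q c -> supported F q.+1 (set_d c).
Proof.
move=> uF cF T cT /set_d_neq0[t tT /cF h].
apply: (uF (T :\ t)); first exact: subsetDl.
by apply: h; move: cT; rewrite (cardsD1 t) tT => -[].
Qed.

Lemma disjoint_setD1 T B t : [disjoint T & B] -> [disjoint T :\ t & B].
Proof. by apply: disjointWl; apply/subsetP=> x; rewrite !inE => /andP[]. Qed.

Lemma disjoint_setU1r (i : 'I_n) S B :
  [disjoint S & i |: B] = (i \notin S) && [disjoint S & B].
Proof.
by rewrite !disjoints_subset setCU subsetI subsetC sub1set inE.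
Qed.

(** Induction on B. For i in B, the sets avoiding B are those avoiding B - i
    and not containing i, whence the exact sequence
    H^q(star A, B - i) -> H^q(star A, B) -> H^(q+1)(star (i + A), B - i),
    whose outer terms vanish: passing from A to i + A raises both the
    cohomological degree and the bound by one. *)
Lemma acyclic_star_off (F : {set 'I_n} -> Prop) (r : int) : upclosed F ->
    (forall A q, A != set0 -> r + #|A|%:Z < q%:Z ->
       acyclic (star F A) set0 q) ->
  forall B A q, A != set0 -> r + #|A|%:Z < q%:Z -> acyclic (star F A) B q.
Proof.
move=> uF vF B; move: {2}#|B| (erefl #|B|) => m.
elim: m B => [|m IH] B cB A q A0 ltq.
  by rewrite (cards0_eq cB); apply: vF.
have [i iB] : exists i, i \in B by apply/set0Pn; rewrite -card_gt0 cB.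
move=> c cF dc.
have [iA|iA] := boolP (i \in A).
  exists (fun=> 0); split=> [? _ ? _|S cS dS]; first by rewrite eqxx.
  rewrite set_d0; apply/eqP/negPn/negP => /(cF _ cS)[_ /subsetP/(_ _ iA) iS].
  by rewrite (disjointFr dS iS) in iB.
have cB' : #|B :\ i| = m by move: cB; rewrite (cardsD1 i) iB => -[].
have disjB S : i \notin S -> [disjoint S & B :\ i] -> [disjoint S & B].
  by move=> iS dS; rewrite -(setD1K iB) disjoint_setU1r iS.
(* Extension of c by zero to the sets containing i: a lift of c to the
   complex of the sets avoiding B - i. *)
pose c' S := if i \in S then 0 else c S.
have c'F : supported (star F A) q c'.
  by move=> S cS; rewrite /c'; case: (i \in S); [rewrite eqxx|apply: cF].
have dc'0 T : #|T| = q.+1 -> [disjoint T & B :\ i] -> i \notin T ->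
    set_d c' T = 0.
  move=> cT dT iT; rewrite -[RHS](dc T) //; last exact: disjB.
  apply: (set_d_eq cT) => t tT _; rewrite /c' inE (negbTE iT) andbF //.
have Ai : #|i |: A|%:Z = #|A|%:Z + 1 by rewrite cardsU1 iA addnC PoszD.
have Ai0 : i |: A != set0 by apply/set0Pn; exists i; rewrite setU11.
(* The image of c under the connecting homomorphism; it lives on the star of
   i + A. *)
pose e T := if i \in T then set_d c' T else 0.
have dce T : #|T| = q.+1 -> [disjoint T & B :\ i] -> set_d c' T = e T.
  by move=> cT dT; rewrite /e; case: (boolP (i \in T)) => // /(dc'0 _ cT dT).
case: (IH _ cB' (i |: A) q.+1 Ai0 _ e).
- by rewrite Ai; lia.
- move=> T cT; rewrite /e.
  case: (boolP (i \in T)) => [iT|]; last by rewrite eqxx.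
  move=> /(supported_set_d (star_upclosed uF) c'F cT)[FT sAT].
  by split=> //; rewrite subUset sub1set iT.
- move=> T cT dT; rewrite -[RHS](set_d_set_d c' T).
  apply: (set_d_eq cT) => t tT ct.
  by rewrite dce // disjoint_setD1.
move=> b' [b'F eb'].
have {}b'F := b'F _ erefl.
case: (IH _ cB' A q A0 ltq (fun S => c' S - b' S)).
- move=> S cS; have [c0|c0 _] := eqVneq (c' S) 0; last exact: c'F.
  rewrite c0 sub0r oppr_eq0 => /(b'F _ cS)[FS]; rewrite subUset => /andP[_ ?].
  by split.
- by move=> T cT dT; rewrite set_dB dce // eb' // subrr.
move=> b [bF hb]; exists b; split=> // S cS dS.
have iS : i \notin S by rewrite (disjointFl dS iB).
rewrite -hb //; last by apply: disjointWr dS; apply: subsetDl.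
rewrite /c' (negbTE iS); have [->|] := eqVneq (b' S) 0; first by rewrite subr0.
by move=> /(b'F _ cS)[_]; rewrite subUset sub1set (negbTE iS).
Qed.

(** Descending induction on B: c is a coboundary off B, at first for B = setT
    and finally for B = set0. *)
Lemma acyclic_of_stars (F : {set 'I_n} -> Prop) (r : int) (p : nat) :
    (0 < n)%N -> upclosed F ->
    (forall A q, A != set0 -> r + #|A|%:Z < q%:Z ->
       acyclic (star F A) set0 q) ->
  r + 1 < p%:Z -> acyclic F set0 p.
Proof.
move=> n0 uF vF ltp c cF dc.
have {}dc T : #|T| = p.+1 -> set_d c T = 0.
  by move=> cT; apply: dc => //; rewrite disjoint_sym disjoints_subset sub0set.
suff H B : exists b, (forall q, q.+1 = p -> supported F q b) /\
    (forall S, #|S| = p -> [disjoint S & B] -> c S = set_d b S) by exact: H.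
move: {2}#|~: B| (erefl #|~: B|) => m; elim: m B => [|m IH] B cB.
  exists (fun=> 0); split=> [? _ ? _|S cS dS]; first by rewrite eqxx.
  have BT : B = setT by rewrite -[B]setCK (cards0_eq cB) setC0.
  have S0 : S = set0.
    by apply/eqP; rewrite -subset0; move: dS; rewrite BT disjoints_subset setCT.
  have p0 : p = 0%N by rewrite -cS S0 cards0.
  (* In degree 0, the value of d c at a singleton is that of c at set0. *)
  have c1 : #|[set Ordinal n0]| = p.+1 by rewrite cards1 p0.
  have /eqP := dc _ c1.
  rewrite /set_d !big_set1 setDv mulf_eq0 (negbTE (sgn_neq0 _ _)) /= => /eqP c0.
  by rewrite big1 ?S0 // => t; rewrite mulr0.
have [i] : exists i, i \in ~: B by apply/set0Pn; rewrite -card_gt0 cB.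
rewrite inE => iB.
have [] := IH (i |: B).
  move: cB; rewrite (cardsD1 i) inE iB => -[<-]; congr #|pred_of_set _|.
  by rewrite setDE setCU setIC.
move=> b [bF cb].
(* Off B, the cocycle c - d b lives on the star of i. *)
pose e S := if i \in S then c S - set_d b S else 0.
have ceb S : #|S| = p -> [disjoint S & B] -> e S = c S - set_d b S.
  move=> cS dS; rewrite /e; case: (boolP (i \in S)) => // iS.
  by rewrite -cb ?subrr // disjoint_setU1r iS.
have i1 : [set i] != set0 by apply/set0Pn; exists i; rewrite set11.
have lt1 : r + #|[set i]|%:Z < p%:Z by rewrite cards1.
have [] := acyclic_star_off uF vF i1 lt1 (B := B) (c := e).
- move=> S cS; rewrite /e.
  case: (boolP (i \in S)) => [iS|]; last by rewrite eqxx.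
  move=> h; split; last by rewrite sub1set.
  have [c0|c0] := eqVneq (c S) 0; last exact: cF.
  move: h; rewrite c0 sub0r oppr_eq0.
  have ep : #|S :\ i|.+1 = p by rewrite -cS (cardsD1 i S) iS.
  by apply: (supported_set_d uF (bF _ ep)); rewrite ep.
- move=> T cT dT.
  rewrite -[RHS](_ : set_d c T - set_d (set_d b) T = 0); last first.
    by rewrite dc // set_d_set_d subrr.
  rewrite -set_dB; apply: (set_d_eq cT) => t tT ct.
  by rewrite ceb // disjoint_setD1.
move=> b1 [b1F eb1]; exists (fun S => b S + b1 S); split=> [q qp S cS|S cS dS].
  have [->|b0 _] := eqVneq (b S) 0; last exact: (bF _ qp _ cS b0).
  by rewrite add0r => /(b1F _ qp _ cS)[].
by rewrite set_dD -eb1 // ceb // addrCA subrr addr0.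
Qed.

End SetCochains.

(** * Coefficients of fractions in degrees of Z^n *)

Section Coefficients.

Variables (k : fieldType) (n : nat).
Local Notation R := {mpoly k[n]}.
Local Notation zdeg := {ffun 'I_n -> int}.
Implicit Types (S T : {set 'I_n}) (f g : R) (a w : zdeg) (m : 'X_{1..n}).
Implicit Types (u v : R^o * nat) (c b : {set 'I_n} -> R^o * nat).

Definition zmnm m : zdeg := [ffun i => (m i)%:Z].

Definition absmnm a : 'X_{1..n} := [multinom `|a i|%N | i < n].

Lemma zmnmK : cancel zmnm absmnm.
Proof. by move=> m; apply/mnmP => i; rewrite mnmE ffunE absz_nat. Qed.

Lemma zmnmD m1 m2 : zmnm (m1 + m2)%MM = zmnm m1 + zmnm m2.
Proof. by apply/ffunP => i; rewrite !ffunE mnmDE PoszD. Qed.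

Definition effective a := zmnm (absmnm a) == a.

Lemma effectiveP a : reflect (forall i, 0 <= a i) (effective a).
Proof.
apply: (iffP eqP) => [<- i|ge0]; first by rewrite ffunE.
by apply/ffunP => i; rewrite ffunE mnmE gez0_abs.
Qed.

Lemma effective_zmnm m : effective (zmnm m).
Proof. by rewrite /effective zmnmK. Qed.

(** The coefficient of x^a in f for any a in Z^n. Allowing negative exponents
    makes multiplication by a monomial a mere translation of the degrees. *)
Definition ecoef f a : k := if effective a then f@_(absmnm a) else 0.

Lemma ecoef_zmnm f m : ecoef f (zmnm m) = f@_m.
Proof. by rewrite /ecoef effective_zmnm zmnmK. Qed.

Lemma ecoefD f g a : ecoef (f + g) a = ecoef f a + ecoef g a.
Proof. by rewrite /ecoef; case: ifP; rewrite ?mcoeffD ?addr0. Qed.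

Lemma ecoef0 a : ecoef 0 a = 0.
Proof. by rewrite /ecoef mcoeff0 if_same. Qed.

Lemma ecoefC x f a : ecoef (x%:MP * f) a = x * ecoef f a.
Proof. by rewrite /ecoef; case: ifP; rewrite ?mcoeffCM ?mulr0. Qed.

Lemma ecoefX m a : ecoef 'X_[m] a = (zmnm m == a)%:R.
Proof.
rewrite /ecoef; case: ifPn => [/eqP ea|nea].
  by rewrite mcoeffX -{2}ea (inj_eq (can_inj zmnmK)).
by case: eqP nea => // <-; rewrite effective_zmnm.
Qed.

Lemma ecoef_inj f g : ecoef f =1 ecoef g -> f = g.
Proof. by move=> h; apply/mpolyP => m; rewrite -!ecoef_zmnm. Qed.

Lemma ecoef_neq0 f a : ecoef f a != 0 -> exists2 m, a = zmnm m & m \in msupp f.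
Proof.
rewrite /ecoef; case: ifP => [/eqP <-|_]; last by rewrite eqxx.
by rewrite zmnmK -mcoeff_msupp => h; exists (absmnm a).
Qed.

Lemma ecoefMX m f a : ecoef ('X_[m] * f) (zmnm m + a) = ecoef f a.
Proof.
have [/eqP ea|nea] := boolP (effective a).
  by rewrite -ea -zmnmD !ecoef_zmnm mulrC mcoeffMX.
rewrite [RHS]/ecoef (negbTE nea); apply/eqP/negPn/negP => /ecoef_neq0[m' em].
rewrite mulrC (perm_mem (msuppMX _ _)) => /mapP[m2 _ e2].
case/negP: nea; move: em; rewrite e2 zmnmD => /addrI ->.
exact: effective_zmnm.
Qed.

(** The degree of (xprod S)^l. *)
Definition zind S (l : nat) : zdeg := [ffun i => ((i \in S) * l)%N%:Z].

Lemma indD S l1 l2 : zind S (l1 + l2) = zind S l1 + zind S l2.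
Proof. by apply/ffunP => i; rewrite !ffunE mulnDr PoszD. Qed.

Lemma xprodX S l : xprod k S ^+ l = 'X_[[multinom ((i \in S) * l)%N | i < n]].
Proof.
rewrite mpolyXE_id /xprod -prodrXl [LHS]big_mkcond; apply: eq_bigr => i _.
by rewrite mnmE; case: (i \in S); rewrite ?mul1n // mul0n expr0.
Qed.

Lemma ecoef_xprod S l f a :
  ecoef (xprod k S ^+ l * f) (a + zind S l) = ecoef f a.
Proof.
rewrite xprodX addrC -[RHS](ecoefMX [multinom ((i \in S) * l)%N | i < n]).
congr (ecoef _ (_ + _)); apply/ffunP => i.
by rewrite !ffunE mnmE.
Qed.

(** The coefficient of x^a in the fraction represented by u. *)
Definition lcoef S u a : k := ecoef u.1 (a + zind S u.2).

(** The ring has no zero divisors, so the exponent l in loc_eq is irrelevant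
    and fractions are separated by their coefficients. *)
Lemma loc_eqP S u v : loc_eq S u v <-> lcoef S u =1 lcoef S v.
Proof.
split=> [[l e] a|e].
  rewrite /lcoef -(ecoef_xprod S (l + v.2) u.1) -(ecoef_xprod S (l + u.2) v.1).
  rewrite -!addrA -!indD; congr ecoef; [exact: e|].
  by congr (_ + zind _ _); lia.
exists 0%N; apply: ecoef_inj => a; rewrite !add0n.
pose d := a - zind S u.2 - zind S v.2.
have ea : a = d + zind S u.2 + zind S v.2 by rewrite addrAC !addrNK.
transitivity (lcoef S u d).
  by rewrite ea; apply: ecoef_xprod.
by rewrite e ea addrAC; apply/esym/ecoef_xprod.
Qed.

Lemma lcoef0 S a : lcoef S (loc0 _) a = 0.
Proof. exact: ecoef0. Qed.

Lemma lcoef_add S u v a : lcoef S (loc_add S u v) a = lcoef S u a + lcoef S v a.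
Proof.
rewrite /lcoef /loc_add /= ecoefD indD addrA ecoef_xprod addrAC.
by rewrite ecoef_xprod.
Qed.

Lemma lcoef_res (t : 'I_n) T u a : t \in T ->
  lcoef T (loc_res t u) a = lcoef (T :\ t) u a.
Proof.
move=> tT; rewrite /lcoef /loc_res /= -[RHS](ecoef_xprod [set t] u.2).
rewrite {1}/xprod big_set1 -addrA ; congr (ecoef _ (_ + _)).
apply/ffunP => i; rewrite !ffunE !inE.
by case: eqVneq => [->|_]; rewrite ?tT ?add0n ?addr0 ?add0r.
Qed.

Lemma lcoef_sign T (t : 'I_n) S u a :
  lcoef S (loc_scale (cech_sign k T t) u) a = sgn k T t * lcoef S u a.
Proof.
rewrite /lcoef /loc_scale /= /cech_sign /sgn -ecoefC; congr (ecoef (_ * _) _).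
by rewrite rmorphXn rmorphN rmorph1.
Qed.

Lemma lcoef_cech_d c T a :
  lcoef T (cech_d c T) a = set_d (fun S => lcoef S (c S) a) T.
Proof.
rewrite /cech_d (big_morph (fun u => lcoef T u a) (id1 := 0) (op1 := +%R)).
- by apply: eq_bigr => t tT; rewrite lcoef_sign lcoef_res.
- by move=> u v; rewrite lcoef_add.
- exact: lcoef0.
Qed.

End Coefficients.

(** * Strands of the Cech complex of a monomial ideal *)

Section MonomialIdeals.

Variables (k : fieldType) (n : nat).
Local Notation R := {mpoly k[n]}.
Local Notation zdeg := {ffun 'I_n -> int}.
Implicit Types (S T : {set 'I_n}) (f g : R) (a w : zdeg) (m : 'X_{1..n}).
Implicit Types (I : {pred R}) (c b : {set 'I_n} -> R^o * nat).

(** The form in which monomial ideals are used: membership is read off the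
    monomials of f, and is inherited by multiples. Unlike generators, these two
    properties pass to colons at once. *)
Definition monomial_closed I :=
  (forall f, f \in I <-> forall m, m \in msupp f -> 'X_[m] \in I) /\
  (forall m m', 'X_[m] \in I -> 'X_[m + m'] \in I).

Lemma monomial_ideal_closed I : monomial_ideal I -> monomial_closed I.
Proof.
case=> G hG.
have I0 : 0 \in I by apply/hG; exists [::]; rewrite ?big_nil.
have ID f g : f \in I -> g \in I -> f + g \in I.
  move=> /hG[s sG ->] /hG[t tG ->]; apply/hG.
  exists (s ++ t); rewrite ?big_cat //.
  by rewrite all_cat sG.
have IG f m : m \in G -> f * 'X_[m] \in I.
  by move=> mG; apply/hG; exists [:: (f, m)]; rewrite ?big_seq1 /= ?mG.
have IM f g : g \in I -> f * g \in I.
  move=> /hG[s sG ->]; apply/hG; exists [seq (f * t.1, t.2) | t <- s].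
    by rewrite all_map.
  by rewrite big_map mulr_sumr; apply: eq_bigr => t _; rewrite mulrA.
split=> [f|m m' mI]; last by rewrite addmC mpolyXD IM.
split=> [/hG[s sG ef] m mf|h].
  suff [t ts /andP[tG]] : exists2 t : R * 'X_{1..n}, t \in s &
      (t.2 \in G) && (m \in msupp (t.1 * 'X_[t.2])).
    rewrite (perm_mem (msuppMX _ _)) => /mapP[m' _ ->].
    by rewrite addmC mpolyXD IG.
  pose inS (t : R * 'X_{1..n}) := m \in msupp (t.1 * 'X_[t.2]).
  have /hasP[t ts tm] : has inS s.
    apply: contraLR mf => /hasPn h; rewrite -mcoeff_eq0 ef raddf_sum /= big_seq.
    by rewrite big1 // => t /h; rewrite /inS -mcoeff_eq0 => /eqP.
  by exists t => //; rewrite (allP sG).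
rewrite (mpolyE f) big_seq; apply: (big_ind (fun g => g \in I)) => // m mf.
by rewrite -mul_mpolyC IM // h.
Qed.

Lemma colon_monomial_closed I i :
  monomial_closed I -> monomial_closed (colon I 'X_i).
Proof.
case=> hI hM; split=> [f|m m']; rewrite !inE /=; last first.
  by rewrite -!mpolyXD -addmA [(m' + _)%MM]addmC addmA; apply: hM.
rewrite hI; split=> h m.
  move=> mf; rewrite inE /= -mpolyXD addmC; apply: h.
  by rewrite (perm_mem (msuppMX _ _)) map_f.
rewrite (perm_mem (msuppMX _ _)) => /mapP[m' /h + ->].
by rewrite inE /= -mpolyXD addmC.
Qed.

(** The total degree |a|. *)
Definition tdeg a : int := \sum_i a i.

Lemma tdeg_zmnm m : tdeg (zmnm m) = (mdeg m)%:Z.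
Proof.
rewrite /tdeg mdegE -natz natr_sum; apply: eq_bigr => i _.
by rewrite ffunE natz.
Qed.

Lemma tdegD a w : tdeg (a + w) = tdeg a + tdeg w.
Proof. by rewrite /tdeg -big_split; apply: eq_bigr => i _; rewrite ffunE. Qed.

Lemma tdeg_ind S l : tdeg (zind S l) = (l * #|S|)%N%:Z.
Proof.
rewrite mulnC -sum_nat_const big_mkcond -natz natr_sum.
by apply: eq_bigr => i _; rewrite ffunE natz; case: ifP; rewrite ?mul1n.
Qed.

Definition zmem I a := effective a && ('X_[absmnm a] \in I).

Lemma zmem_zmnm I m : zmem I (zmnm m) = ('X_[m] \in I).
Proof. by rewrite /zmem effective_zmnm zmnmK. Qed.

Lemma zmem_le I a w : monomial_closed I -> (forall i, a i <= w i) ->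
  zmem I a -> zmem I w.
Proof.
case=> _ hM leaw /andP[/effectiveP a0 aI].
have w0 : effective w by apply/effectiveP => i; apply: le_trans (leaw i).
rewrite /zmem w0 /=.
have -> : absmnm w = (absmnm a + (absmnm w - absmnm a))%MM; last exact: hM.
apply/mnmP => i; rewrite mnmDE mnmBE !mnmE subnKC //.
by move: (a0 i) (leaw i); lia.
Qed.

Lemma ideal_partP I (j : int) f : monomial_closed I ->
  f \in ideal_part I j <-> forall a, ecoef f a != 0 -> tdeg a = j /\ zmem I a.
Proof.
case=> hI hM; rewrite inE; split=> [/andP[/hI fI fj] a /ecoef_neq0[m -> mf]|h].
  rewrite tdeg_zmnm zmem_zmnm; split; last exact: fI.
  case: j fj => j; first by move=> /dhomogP ->.
  by move/eqP=> f0; rewrite f0 msupp0 in mf.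
have {}h m : m \in msupp f -> (mdeg m)%:Z = j /\ 'X_[m] \in I.
  by rewrite mcoeff_msupp -ecoef_zmnm => /h; rewrite tdeg_zmnm zmem_zmnm.
apply/andP; split; first by apply/hI => m /h[].
case: j h => j h; first by apply/dhomogP => m /h[[]].
rewrite -msupp_eq0; case: (msupp f) h => // m s h.
by have [] := h m (mem_head _ _).
Qed.

Lemma cech_cochainP I (j : int) S (u : R^o * nat) : monomial_closed I ->
  u.1 \in ideal_part I (j + (u.2 * #|S|)%N%:Z) <->
  forall a, lcoef S u a != 0 -> tdeg a = j /\ zmem I (a + zind S u.2).
Proof.
move=> hI; split=> [/(ideal_partP _ _ hI) h a /h [+ ?]|h].
  by rewrite tdegD tdeg_ind => /addIr.
apply/(ideal_partP _ _ hI) => a; rewrite -[a](subrK (zind S u.2)).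
by move=> /h[e aI]; rewrite tdegD tdeg_ind e.
Qed.

(** x^a lies in the localization of I at xprod S. *)
Definition deg_family I a S : Prop := exists l, zmem I (a + zind S l).

Lemma zmem_ind I a S l : monomial_closed I ->
  zmem I a -> zmem I (a + zind S l).
Proof. by move=> hI; apply: zmem_le => // i; rewrite !ffunE lerDl. Qed.

Lemma deg_family_upclosed I a : monomial_closed I -> upclosed (deg_family I a).
Proof.
move=> hI S T sST [l h]; exists l; apply: zmem_le h => // i.
rewrite !ffunE lerD2l lez_nat leq_mul2r; apply/orP; right.
by case: (boolP (i \in S)) => // /(subsetP sST) ->.
Qed.

(** A cochain on F_a(I) is the strand of degree a of a Cech cochain: multiply
    by x^a, with a power of xprod S in the denominator that is large enough for
    the numerator to be in I. *)
Lemma lift_slice I a (c : {set 'I_n} -> k) : monomial_closed I ->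
  exists b : {set 'I_n} -> R^o * nat, forall S,
    (c S != 0 -> deg_family I a S) ->
    (b S).1 \in ideal_part I (tdeg a + ((b S).2 * #|S|)%N%:Z) /\
    forall w, lcoef S (b S) w = if w == a then c S else 0.
Proof.
move=> hI.
suff: forall S, exists u : R^o * nat, (c S != 0 -> deg_family I a S) ->
    u.1 \in ideal_part I (tdeg a + (u.2 * #|S|)%N%:Z) /\
    forall w, lcoef S u w = if w == a then c S else 0 by exact: fin_all_exists.
move=> S; have [c0|c0] := eqVneq (c S) 0.
  exists (loc0 _) => _; have l0 w := lcoef0 k S w; split=> [|w].
    by apply/cech_cochainP => // w; rewrite l0 eqxx.
  by rewrite l0 c0 if_same.
have [[l ml]|h] := classic (deg_family I a S); last first.
  by exists (loc0 _) => /(_ isT).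
pose u : R^o * nat := ((c S)%:MP * 'X_[absmnm (a + zind S l)], l).
exists u => _.
have lu w : lcoef S u w = if w == a then c S else 0.
  rewrite /lcoef ecoefC ecoefX; case/andP: ml => /eqP -> _ /=.
  rewrite (inj_eq (addIr _)) eq_sym; case: ifP => _; first by rewrite mulr1.
  by rewrite mulr0.
split=> //; apply/cech_cochainP => // w; rewrite lu.
by case: (eqVneq w a) => [->|_]; rewrite ?eqxx.
Qed.

(** A cocycle on F_a(I) lifts to a Cech cocycle; if this is the coboundary of b,
    the given cocycle is the coboundary of the coefficients of b in degree a. *)
Lemma acyclic_of_local_cohomology_eq0 I (p : nat) (j : int) a :
    monomial_closed I ->
  ~ local_cohomology_neq0 (ideal_part I) p j -> tdeg a = j ->
  acyclic k (deg_family I a) set0 p.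
Proof.
move=> hI hno aj c cF dc.
have [e he] := lift_slice a c hI.
have he2 S w : #|S| = p -> lcoef S (e S) w = if w == a then c S else 0.
  by move=> cS; apply: (he S (cF S cS)).2.
have [b [bC hb]] : cech_coboundary (ideal_part I) p j e.
  apply: NNPP => nb; apply: hno; exists e; split=> //; split=> [S cS|T cT].
    by rewrite -aj; apply: (he S (cF S cS)).1.
  apply/loc_eqP => w; rewrite lcoef0 lcoef_cech_d.
  have disjT : [disjoint T & set0].
    by rewrite disjoint_sym disjoints_subset sub0set.
  have [->|wa] := eqVneq w a.
    rewrite -[RHS](dc T cT disjT); apply: (set_d_eq cT) => t tT ct.
    by rewrite he2 // eqxx.
  rewrite -[RHS](set_d0 k T); apply: (set_d_eq cT) => t tT ct.
  by rewrite he2 // (negbTE wa).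
exists (fun S => lcoef S (b S) a); split=> [q qp S cS|S cS _].
  have /(cech_cochainP _ _ _ hI) h := bC q qp S cS.
  by move=> /h[_ ?]; exists (b S).2.
have /loc_eqP/(_ a) := hb S cS.
by rewrite lcoef_cech_d he2 // eqxx.
Qed.

(** Only finitely many degrees occur in a Cech cocycle. In each of them the
    strand of the cocycle is a coboundary d b_a, and the cocycle is d of the sum
    of the lifts of the b_a. *)
Lemma coboundary_of_slices I (p : nat) (j : int) c : monomial_closed I ->
    (forall a, tdeg a = j -> acyclic k (deg_family I a) set0 p) ->
  cech_cocycle (ideal_part I) p j c -> cech_coboundary (ideal_part I) p j c.
Proof.
move=> hI hac [cC dc].
have cP S a : #|S| = p -> lcoef S (c S) a != 0 ->
    tdeg a = j /\ deg_family I a S.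
  move=> cS; have /(cech_cochainP _ _ _ hI) h := cC S cS.
  by move=> /h[aj ?]; split=> //; exists (c S).2.
(* L is the list of the degrees already treated. *)
suff partial (L : seq zdeg) : uniq L -> exists b,
    (forall q, q.+1 = p -> cech_cochain (ideal_part I) q j b) /\
    forall S w, #|S| = p ->
      lcoef S (cech_d b S) w = if w \in L then lcoef S (c S) w else 0.
  pose degs S := [seq zmnm m - zind S (c S).2 | m <- msupp (c S).1].
  pose L := undup (flatten [seq degs U | U <- enum {set 'I_n}]).
  have [b [bC hb]] := partial L (undup_uniq _).
  exists b; split=> // S cS; apply/loc_eqP => w; rewrite hb //.
  case: ifPn => // wL; apply/eqP/negPn.
  apply: contra wL => /ecoef_neq0[m em mf].
  rewrite mem_undup; apply/flatten_mapP; exists S; first by rewrite mem_enum.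
  by apply/mapP; exists m => //; rewrite -em addrK.
elim: L => [_|a L IH /= /andP[aL /IH[b [bC hb]]]].
  exists (fun=> loc0 _); split=> [q _ S _|S w cS].
    by apply/cech_cochainP => // w; rewrite lcoef0 eqxx.
  rewrite lcoef_cech_d -[RHS](set_d0 k S); apply: eq_bigr => t _.
  by rewrite lcoef0.
(* In a degree of the wrong total the cocycle has no coefficient; b1 must be
   zero there for its lift to be homogeneous of degree j. *)
have [b1 [b1F hb1]] : exists b1 : {set 'I_n} -> k,
    (forall q, q.+1 = p -> supported (deg_family I a) q b1) /\
    (tdeg a <> j -> b1 =1 fun=> 0) /\
    forall S, #|S| = p -> lcoef S (c S) a = set_d b1 S.
  have [aj|aj] := eqVneq (tdeg a) j; last first.
    exists (fun=> 0); split=> [q _ S _|]; first by rewrite eqxx.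
    split=> // S cS; rewrite set_d0; apply/eqP/negPn/negP => /(cP _ _ cS)[e _].
    by rewrite e eqxx in aj.
  have [] := hac a aj (fun S => lcoef S (c S) a).
  - by move=> S cS /(cP _ _ cS)[].
  - move=> T cT _; have /loc_eqP/(_ a) := dc T cT.
    by rewrite lcoef_cech_d lcoef0.
  move=> b1 [b1F hb1]; exists b1; split=> //; split=> // S cS.
  by apply: hb1 => //; rewrite disjoint_sym disjoints_subset sub0set.
case: hb1 => b10 hb1.
have [e he] := lift_slice a b1 hI.
exists (fun S => loc_add S (b S) (e S)); split=> [q qp S cS|S w cS].
  apply/cech_cochainP => // w h.
  have /(cech_cochainP _ _ _ hI) hb' := bC q qp S cS.
  have [/(cech_cochainP _ _ _ hI) he1 he2] := he S (b1F q qp S cS).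
  move: h; rewrite lcoef_add.
  have [b0|/hb'[wj wI] _] := eqVneq (lcoef S (b S) w) 0.
    rewrite b0 add0r => he0; have [aw wI] := he1 _ he0; split.
      rewrite aw; apply: NNPP => /b10 z; move: he0.
      by rewrite he2 z if_same eqxx.
    by rewrite /loc_add /= addnC indD addrA; apply: zmem_ind.
  by split=> //; rewrite /loc_add /= indD addrA; apply: zmem_ind.
have step : lcoef S (cech_d (fun S => loc_add S (b S) (e S)) S) w =
    lcoef S (cech_d b S) w + (if w == a then set_d b1 S else 0).
  rewrite !lcoef_cech_d.
  have -> : (if w == a then set_d b1 S else 0) =
      set_d (fun S => if w == a then b1 S else 0) S.
    by case: ifP; rewrite ?set_d0.
  rewrite -set_dD; apply: eq_bigr => t tS; rewrite lcoef_add.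
  have ct : (#|S :\ t|).+1 = p by rewrite -cS (cardsD1 t S) tS.
  by have [_ ->] := he (S :\ t) (b1F _ ct _ erefl).
rewrite step hb // inE; case: eqVneq => [->|_] /=; last by rewrite addr0.
by rewrite (negbTE aL) add0r hb1.
Qed.

Theorem local_cohomology_slices I (p : nat) (j : int) : monomial_closed I ->
  local_cohomology_neq0 (ideal_part I) p j <->
  exists2 a, tdeg a = j & ~ acyclic k (deg_family I a) set0 p.
Proof.
move=> hI; split=> [[c [cZ ncB]]|[a aj na]].
  apply: NNPP => h; apply: ncB; apply: coboundary_of_slices => // a aj.
  by apply: NNPP => na; apply: h; exists a.
by apply: NNPP => h; apply: na; apply: acyclic_of_local_cohomology_eq0 h aj.
Qed.

End MonomialIdeals.

(** * Colon ideals *)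

Section Colon.

Variables (k : fieldType) (n : nat).
Local Notation R := {mpoly k[n]}.
Local Notation zdeg := {ffun 'I_n -> int}.
Implicit Types (S A : {set 'I_n}) (a : zdeg) (I : {pred R}) (i : 'I_n).

Lemma zmem_colon I i a :
  zmem (colon I 'X_i) a = effective a && zmem I (a + zmnm U_(i)).
Proof.
rewrite /zmem; case: (boolP (effective a)) => //= /eqP ea.
rewrite inE /= -mpolyXD -{2}ea -zmnmD effective_zmnm /=.
by rewrite -[in RHS]ea -zmnmD zmnmK.
Qed.

Lemma deg_family_colon_ge0 I i a S : 0 <= a i ->
  deg_family (colon I 'X_i) a S <-> deg_family I (a + zmnm U_(i)) S.
Proof.
move=> ai; have eA l : a + zmnm U_(i) + zind S l = a + zind S l + zmnm U_(i).
  by rewrite addrAC.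
split=> -[l h]; exists l; first by move: h; rewrite zmem_colon eA => /andP[].
rewrite zmem_colon -eA h andbT; case/andP: h => /effectiveP h _.
apply/effectiveP => t; move: (h t); rewrite !ffunE mnm1E.
by case: eqVneq => [<-|_]; rewrite ?addr0 // => _; apply: addr_ge0.
Qed.

(** A set S of either family contains i, as a_i < 0; so x_i is invertible in
    the localization at xprod S. *)
Lemma deg_family_colon_lt0 I i a S : monomial_closed I -> a i < 0 ->
  deg_family (colon I 'X_i) a S <-> deg_family I a S.
Proof.
move=> hI ai; split=> -[l].
  rewrite zmem_colon => /andP[/effectiveP/(_ i)].
  rewrite !ffunE; case: (boolP (i \in S)) => [iS _|_ /=]; last first.
    by rewrite mul0n; lia.
  move=> h; exists l.+1; apply: zmem_le h => // t; rewrite !ffunE mnm1E.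
  by case: eqVneq => [<-|_]; [rewrite iS|case: (t \in S)]; lia.
move=> h; exists l; rewrite zmem_colon; case/andP: (h) => -> _.
by apply: zmem_le h => // t; rewrite !ffunE mnm1E; lia.
Qed.

(** In degree -1_A the fractions exist only over sets S containing A, and
    there xprod A is invertible. *)
Lemma deg_family_star I A S : monomial_closed I ->
  deg_family I (- zind A 1) S <-> star (deg_family I 0) A S.
Proof.
move=> hI; split=> [[l h]|[[l h] /subsetP sAS]].
  split.
    by exists l; apply: zmem_le h => // t; rewrite !ffunE; lia.
  apply/subsetP => t tA; case/andP: h => /effectiveP/(_ t) + _.
  by rewrite !ffunE tA; case: (t \in S) => //; lia.
exists l.+1; apply: zmem_le h => // t; rewrite !ffunE.
by case: (boolP (t \in A)) => [/sAS ->|_]; [|case: (t \in S)]; lia.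
Qed.

(** The three cases: a has a negative entry, a = 0, a has a positive entry. *)
Lemma acyclic_of_colons I (r : int) (p : nat) a :
    (0 < n)%N -> monomial_closed I ->
    (forall i q a', r < q%:Z + tdeg a' ->
       acyclic k (deg_family (colon I 'X_i) a') set0 q) ->
  r + 1 < p%:Z + tdeg a -> acyclic k (deg_family I a) set0 p.
Proof.
move=> n0 hI hcol lta.
have neg a' i q : a' i < 0 -> r < q%:Z + tdeg a' ->
    acyclic k (deg_family I a') set0 q.
  move=> ai /(hcol i); apply: acyclic_ext => S.
  exact: deg_family_colon_lt0.
have [a0|] := eqVneq a 0.
  have t0 : tdeg a = 0 by rewrite a0 /tdeg big1 // => i _; rewrite ffunE.
  rewrite a0; apply: (@acyclic_of_stars _ _ _ r) => //.
  - exact: deg_family_upclosed.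
  - move=> A q /set0Pn[i iA] ltq.
    apply: acyclic_ext (fun S => deg_family_star A S hI) _.
    apply: (neg _ i); first by rewrite !ffunE iA.
    have := tdegD (- zind A 1) (zind A 1); rewrite addNr -a0 t0 tdeg_ind; lia.
  - by move: lta; rewrite t0 addr0.
move=> nea; have [i ai] : exists i, a i != 0.
  apply: NNPP => h; case/eqP: nea; apply/ffunP => i; rewrite ffunE.
  by apply/eqP/negPn/negP => ai; apply: h; exists i.
have [lt0|ge0] := ltrP (a i) 0; first by apply: (neg a i) => //; lia.
have e : a = (a - zmnm U_(i)) + zmnm U_(i) by rewrite subrK.
have te : tdeg a = tdeg (a - zmnm U_(i)) + 1.
  by rewrite {1}e tdegD tdeg_zmnm mdeg1.
rewrite e; apply: acyclic_ext (hcol i p (a - zmnm U_(i)) _); last by lia.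
have gt0 : 0 < a i by rewrite lt_def ai.
move=> S; apply: deg_family_colon_ge0; rewrite !ffunE mnm1E eqxx /=; lia.
Qed.

Lemma colon_acyclic_of_acyclic I i (p : nat) : monomial_closed I ->
    (forall a, acyclic k (deg_family I a) set0 p) ->
  forall a, acyclic k (deg_family (colon I 'X_i) a) set0 p.
Proof.
move=> hI hac a; have [lt0|ge0] := ltrP (a i) 0.
  by apply: acyclic_ext (hac a) => S; symmetry; apply: deg_family_colon_lt0.
apply: acyclic_ext (hac (a + zmnm U_(i))) => S; symmetry.
exact: deg_family_colon_ge0.
Qed.

End Colon.

(** * The regularity bound *)

Lemma bounded_int_max (P : int -> Prop) (B : int) :
    (exists x, P x) -> (forall x, P x -> x <= B) ->
  exists2 s, P s & forall x, P x -> x <= s.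
Proof.
case=> x Px leB; have [d ed] : exists d : nat, B - x <= d%:Z.
  by exists `|B - x|%N; lia.
elim: d x Px ed => [|d IH] x Px ed.
  by exists x => // y /leB; lia.
have [[y Py lty]|h] := classic (exists2 y, P y & x < y).
  by apply: (IH y) => //; lia.
exists x => // y Py; rewrite leNgt; apply/negP => lty.
by apply: h; exists y.
Qed.

Theorem proposition4p9 (k : fieldType) (n : nat) (hn : (1 <= n)%N)
    (I : {pred {mpoly k[n]}}) (hI : monomial_ideal I)
    (hI0 : exists2 g, g \in I & g != 0) (r : int)
    (hreg : forall i : 'I_n,
       exists2 s : int, is_ideal_reg (colon I 'X_i) s & s <= r) :
  exists2 s : int, is_ideal_reg I s & s <= r + 1.
Proof.
have mI := monomial_ideal_closed hI.
have mC i := colon_monomial_closed i mI.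
have bound p j : local_cohomology_neq0 (ideal_part I) p j -> p%:Z + j <= r + 1.
  case/(local_cohomology_slices _ _ mI) => a <- na.
  rewrite leNgt; apply/negP => lta; apply: na.
  apply: (@acyclic_of_colons _ _ _ r) => // i q a' lta'.
  apply: NNPP => na; have [s [_ hs] les] := hreg i.
  have := hs q (tdeg a'); rewrite (local_cohomology_slices _ _ (mC i)) => h.
  by have := h (ex_intro2 _ _ a' erefl na); lia.
pose P x :=
  exists p j, local_cohomology_neq0 (ideal_part I) p j /\ x = p%:Z + j.
have [||s [p [j [hpj es]]] hs] := @bounded_int_max P (r + 1).
- have [s [[p [j [h _]]] _] _] := hreg (Ordinal hn).
  apply: NNPP => hP; have [a _ []] := (local_cohomology_slices p j (mC _)).1 h.
  apply: colon_acyclic_of_acyclic => // a'.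
  apply: NNPP => na; apply: hP; exists (p%:Z + tdeg a'), p, (tdeg a').
  by split=> //; apply/local_cohomology_slices => //; exists a'.
- by move=> x [p [j [h ->]]]; apply: bound.
exists s; last by rewrite es; apply: bound.
split; first by exists p, j.
by move=> q i h; apply: hs; exists q, i.
Qed.
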